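(* Every 2-local derivation of a finite dimensional formally real Jordan algebra $\mathcal{A}$ is a derivation.
   Context: A real Jordan algebra is formally real if $\sum_i a_i^2=0$ (finite sum) implies each $a_i=0$. A derivation is a linear map $D$ with $D(xy)=D(x)y+xD(y)$. A 2-local derivation is a map $\Delta:\mathcal{A}\to\mathcal{A}$ (not assumed linear) such that for every $x,y\in\mathcal{A}$ there is a derivation $D_{x,y}$ with $\Delta(x)=D_{x,y}(x)$ and $\Delta(y)=D_{x,y}(y)$. *)

(* Defs.v *)
From HB Require Import structures.
From mathcomp Require Import all_boot all_order all_algebra.
From mathcomp Require Import reals.
Set Implicit Arguments. Unset Strict Implicit. Unset Printing Implicit Defensive.
Import Order.TTheory GRing.Theory Num.Theory.
Local Open Scope ring_scope.

Section Jordan.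
Variables (R : realType) (A : vectType R).

Definition is_jordan_product (mul : A -> A -> A) : Prop :=
  [/\ (forall (a : R) (x y z : A), mul (a *: x + y) z = a *: mul x z + mul y z),
      (forall (a : R) (x y z : A), mul x (a *: y + z) = a *: mul x y + mul x z),
      (forall x y : A, mul x y = mul y x) &
      (forall x y : A, mul (mul (mul x x) y) x = mul (mul x x) (mul y x))].

Definition formally_real (mul : A -> A -> A) : Prop :=
  forall s : seq A, \sum_(a <- s) mul a a = 0 -> forall a, a \in s -> a = 0.

Definition is_derivation (mul : A -> A -> A) (D : A -> A) : Prop :=
  (forall (a : R) (x y : A), D (a *: x + y) = a *: D x + D y) /\
  (forall x y : A, D (mul x y) = mul (D x) y + mul x (D y)).

Definition is_2local_derivation (mul : A -> A -> A) (Delta : A -> A) : Prop :=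
  forall x y : A, exists D : A -> A,
    [/\ is_derivation mul D, Delta x = D x & Delta y = D y].
End Jordan.

(* Main.v *)
Require Import Defs.
From HB Require Import structures.
From mathcomp Require Import all_boot all_order all_algebra.
From mathcomp Require Import reals.
From mathcomp Require Import ring lra.

(** Put t(z) = tr L(z), where L(z) is multiplication by z.  For a derivation D,
    L(D z) = [D, L(z)] has trace 0, so D is skew for the form t(xy); hence so is a
    2-local derivation Delta, as skewness only involves two points at a time.  A skew
    map for a nondegenerate form is linear, and Delta(x^2) = 2 x Delta(x) then
    polarizes to the Leibniz rule.
    Nondegeneracy: a nonzero x is not nilpotent because the algebra is formally real,
    so the associative algebra of polynomials in x without constant term contains an
    idempotent e = x y != 0, and t(e) > 0 by the Peirce decomposition. *)

Set Implicit Arguments. Unset Strict Implicit. Unset Printing Implicit Defensive.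
Import Order.TTheory GRing.Theory Num.Theory VectorInternalTheory.
Local Open Scope ring_scope.

(** In the rank factorization of [P], idempotency makes the two factors multiply to 1 in the other
    order. *)
Lemma mxtrace_idempotent (F : fieldType) (n : nat) (P : 'M[F]_n) :
  P *m P = P -> \tr P = (\rank P)%:R.
Proof.
move=> PP; rewrite -[in LHS](mulmx_base P) mxtrace_mulC.
suff -> : row_base P *m col_base P = 1%:M by rewrite mxtrace1.
apply: (row_full_inj (col_base_full P)); apply: (row_free_inj (row_base_free P)).
by rewrite mulmxA mulmx_base -mulmxA mulmx_base PP mulmx1 mulmx_base.
Qed.

Section Operators.
Variables (R : fieldType) (A : vectType R).

(** Acts on row vectors from the right, so composites of operators appear in reverse order. *)
Definition opmx (f : A -> A) : 'M[R]_(dim A) := lin1_mx (v2r \o f \o r2v).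

Lemma opmxE (f : A -> A) : linear f -> forall u, v2r u *m opmx f = v2r (f u).
Proof.
move=> fL u; pose g : {linear A -> A} := HB.pack f (GRing.isLinear.Build _ _ _ _ f fL).
by rewrite /opmx (mul_rV_lin1 (v2r \o g \o r2v)) /= v2rK.
Qed.

Lemma opmx_eq (M N : 'M[R]_(dim A)) :
  (forall u : A, v2r u *m M = v2r u *m N) -> M = N.
Proof.
move=> eMN; apply/row_matrixP=> i.
by rewrite !rowE -[delta_mx 0 i](@r2vK _ A) eMN.
Qed.

End Operators.

Section JordanTheory.
Variables (R : realType) (A : vectType R) (mul : A -> A -> A).
Hypothesis hJ : is_jordan_product mul.

Lemma jmul_linear x : linear (mul x).
Proof. by case: hJ => _ h _ _ a y z; rewrite h. Qed.
HB.instance Definition _ x := GRing.isLinear.Build R A A *:%R (mul x) (jmul_linear x).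

Lemma jmulC x y : mul x y = mul y x. Proof. by case: hJ. Qed.
Lemma jmulDr x y z : mul x (y + z) = mul x y + mul x z. Proof. exact: linearD. Qed.
Lemma jmulNr x y : mul x (- y) = - mul x y. Proof. exact: linearN. Qed.
Lemma jmulDl x y z : mul (y + z) x = mul y x + mul z x.
Proof. by rewrite !(jmulC _ x) linearD. Qed.
Lemma jmulNl x y : mul (- y) x = - mul y x.
Proof. by rewrite !(jmulC _ x) linearN. Qed.
Lemma jmulZl a x y : mul (a *: y) x = a *: mul y x.
Proof. by rewrite !(jmulC _ x) linearZ. Qed.

Lemma jmul_sqr_comm x u : mul x (mul (mul x x) u) = mul (mul x x) (mul x u).
Proof. by case: hJ => _ _ _ h; rewrite jmulC h (jmulC u). Qed.

(* The part linear in [z] of the Jordan identity at [x + z], as operators in [z]: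
   L(x^2 y) = 2 L(xy) L(x) + L(x^2) L(y) - 2 L(x) L(y) L(x). *)
Lemma jordan_linearized x y z :
  mul (mul (mul x x) y) z =
  mul (mul x y) (mul x z) *+ 2 + mul (mul x x) (mul y z)
    - mul x (mul y (mul x z)) *+ 2.
Proof.
(* The difference of the identities at [x + z] and [x - z] is odd in [z]; the identity at [z]
   removes its cubic part. *)
have e1 := jmul_sqr_comm (x + z) y; have e2 := jmul_sqr_comm (x - z) y.
have e3 := jmul_sqr_comm z y.
move: e1 e2 e3; rewrite !(jmulDr, jmulDl, jmulNr, jmulNl, opprK).
rewrite !(jmulC z x) (jmulC (mul x z) (mul x y)) (jmulC (mul (mul x x) y) z).
rewrite (jmulC y (mul x z)) (jmulC y z).
move=> e1 e2 e3; apply: (@v2r_inj _ A); apply/rowP=> i.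
have f w1 w2 : w1 = w2 -> v2r w1 0 i = v2r w2 0 i :> R by move->.
move: (f _ _ e1) (f _ _ e2) (f _ _ e3); rewrite !(mulr2n, linearD, linearN, opprD, mxE) /=.
move=> {e1 e2 e3 f}; lra.
Qed.

(** * Powers of one element and polynomials in it *)

Fixpoint jpow x n := if n is n'.+1 then mul x (jpow x n') else x.

Lemma jmul_sqr_jpow x n : mul (mul x x) (jpow x n) = jpow x n.+2.
Proof.
elim: n => [|n IHn]; first exact: jmulC.
by rewrite /= -jmul_sqr_comm IHn.
Qed.

(** By [jordan_linearized], L(x^(n+3)) is a polynomial in L(x), L(x^2), L(x^(n+1)) and L(x^(n+2));
    hence the two-step induction. *)
Lemma jpow_comm x n u : mul x (mul (jpow x n) u) = mul (jpow x n) (mul x u).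
Proof.
suff [] : (forall u, mul x (mul (jpow x n) u) = mul (jpow x n) (mul x u)) /\
  (forall u, mul x (mul (jpow x n.+1) u) = mul (jpow x n.+1) (mul x u)) by [].
elim: n {u} => [|n [IHn IHn1]]; first by split=> //= u; rewrite jmul_sqr_comm.
split=> // u; rewrite -jmul_sqr_jpow !jordan_linearized -/(jpow x n.+1).
rewrite !(linearD, linearN, linearMn) /=.
by rewrite !(IHn, IHn1, jmul_sqr_comm).
Qed.

(* [jpoly x p] is the value of ['X * p] at [x]; the shift is there because the
   algebra need not have a unit. *)
Definition jpoly x (p : {poly R}) := \sum_(i < size p) p`_i *: jpow x i.

Lemma jpoly_wide x (p : {poly R}) n : (size p <= n)%N ->
  jpoly x p = \sum_(i < n) p`_i *: jpow x i.
Proof.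
move=> le_p; rewrite /jpoly (big_ord_widen n (fun i => p`_i *: jpow x i) le_p).
rewrite big_mkcond; apply: eq_bigr => i _; case: ltnP => // le_i.
by rewrite nth_default// scale0r.
Qed.

Lemma jpoly_linear x : linear (jpoly x).
Proof.
move=> a p q; set n := maxn (size (a *: p + q)) (maxn (size p) (size q)).
rewrite !(@jpoly_wide x _ n) /n ?leq_max ?leqnn ?orbT//.
rewrite scaler_sumr -big_split; apply: eq_bigr => i _ /=.
by rewrite coefD coefZ scalerDl scalerA.
Qed.
HB.instance Definition _ x :=
  GRing.isLinear.Build R {poly R} A *:%R (jpoly x) (jpoly_linear x).

Lemma jpolyD x p q : jpoly x (p + q) = jpoly x p + jpoly x q. Proof. exact: linearD. Qed.
Lemma jpolyB x p q : jpoly x (p - q) = jpoly x p - jpoly x q. Proof. exact: linearB. Qed.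
Lemma jpolyZ x a p : jpoly x (a *: p) = a *: jpoly x p. Proof. exact: linearZ. Qed.
Lemma jpoly0 x : jpoly x 0 = 0. Proof. exact: linear0. Qed.

Lemma jpolyC x a : jpoly x a%:P = a *: x.
Proof. by rewrite (jpoly_wide _ (size_polyC_leq1 a)) big_ord1 coefC. Qed.

Lemma jpolyMX x p : jpoly x (p * 'X) = mul x (jpoly x p).
Proof.
rewrite (@jpoly_wide x _ (size p).+1); last first.
  by rewrite (leq_trans (size_polyMleq _ _))// size_polyX addn2.
rewrite big_ord_recl coefMX scale0r add0r linear_sum.
by apply: eq_bigr => i _; rewrite linearZ coefMX.
Qed.

Lemma jpoly_comm x p u : mul x (mul (jpoly x p) u) = mul (jpoly x p) (mul x u).
Proof.
rewrite !(jmulC (jpoly x p)) /jpoly !linear_sum; apply: eq_bigr => i _.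
by rewrite !linearZ /= !(jmulC _ (jpow x i)) jpow_comm.
Qed.

(** Power associativity; the extra ['X] comes from the shift in [jpoly]. *)
Lemma jpolyM x p q : mul (jpoly x p) (jpoly x q) = jpoly x (p * q * 'X).
Proof.
elim/poly_ind: q => [|q c IHq]; first by rewrite mulr0 mul0r !jpoly0 linear0.
rewrite [jpoly x (q * _ + _)]jpolyD jpolyMX jpolyC jmulDr -jpoly_comm IHq linearZ /=.
rewrite (jmulC _ x) -!jpolyMX -jpolyZ -jpolyD -mul_polyC.
by congr jpoly; ring.
Qed.

Lemma jpoly_eq0M x p q : jpoly x p = 0 -> jpoly x (p * q) = 0.
Proof.
move=> p0; elim/poly_ind: q => [|q c IHq]; first by rewrite mulr0 jpoly0.
by rewrite mulrDr mulrA jpolyD jpolyMX IHq linear0 mulrC mul_polyC jpolyZ p0 scaler0 addr0.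
Qed.

(** The first dim A + 1 powers of [x] are linearly dependent. *)
Lemma jpoly_annihilated x : exists2 p : {poly R}, p != 0 & jpoly x p = 0.
Proof.
pose M := \matrix_(i < (dim A).+1) v2r (jpow x i).
have /rowV0Pn[u /sub_kermxP uM u_neq0] : kermx M != 0.
  by rewrite kermx_eq0 /row_free neq_ltn ltnS rank_leq_col.
exists (rVpoly u); first by apply: contraNneq u_neq0 => u0; rewrite -(rVpolyK u) u0 linear0.
rewrite (@jpoly_wide x _ (dim A).+1) ?size_poly//.
apply: (@v2r_inj _ A); rewrite linear0 -uM mulmx_sum_row linear_sum.
by apply: eq_bigr => i _; rewrite coef_rVpoly_ord linearZ rowK.
Qed.

(* Fitting decomposition: if ['X^k * r] with [r.[0] != 0] annihilates [x], and
   ['X * s] is [1] modulo [r], then the value of [('X * s)^k.+1] is the idempotent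
   onto the part of [R[x]] on which [x] is invertible. *)
Lemma jordan_idempotent_or_nilpotent x :
  (exists n, jpow x n = 0) \/
  (exists e y, [/\ e != 0, mul e e = e & e = mul x y]).
Proof.
have [p p_neq0 px0] := jpoly_annihilated x.
have [k [r]] := multiplicity_XsubC p 0.
rewrite p_neq0 subr0 /= => r0 pE.
have /factor_theorem[s'] : root (r - r.[0]%:P) 0 by rewrite rootE !hornerE subrr.
rewrite subr0 => rE; pose c := r.[0]; pose s := - c^-1 *: s'.
have c_neq0 : c != 0 by [].
have sE : 1 - s * 'X = c^-1 *: r.
  rewrite -[r](subrK r.[0]%:P) rE /s scalerDr -!mul_polyC -polyCM mulVf// rmorphN /= polyC1.
  by ring.
(* Chosen so that [q * 'X] is [(s * 'X) ^+ k.+1], whose value at [x] is [jpoly x q]. *)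
pose q := s ^+ k.+1 * 'X^k.
have [w wE] : exists w, 1 - q * 'X = r * w.
  have -> : q * 'X = (s * 'X) ^+ k.+1 by rewrite /q exprMn (exprSr 'X) mulrA.
  exists (c^-1%:P * \sum_(i < k.+1) (s * 'X) ^+ i).
  by rewrite -opprB subrX1 -mulNr opprB sE -mul_polyC; ring.
have kill t : 'X^k * t * (1 - q * 'X) = p * (t * w) by rewrite wE pE; ring.
have [q0|q_neq0] := eqVneq (jpoly x q) 0; [left|right].
  have powE n : jpow x n = jpoly x 'X^n.
    elim: n => [|n IHn]; first by rewrite jpolyC scale1r.
    by rewrite exprSr jpolyMX -IHn.
  exists k; rewrite powE; have := kill 1; rewrite mulr1 mulrBr mulr1.
  move/(congr1 (jpoly x)); rewrite jpolyB jpoly_eq0M// mulrA -jpolyM q0 linear0 subr0; exact.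
have qq : mul (jpoly x q) (jpoly x q) = jpoly x q.
  apply/eqP; rewrite eq_sym -subr_eq0 jpolyM -jpolyB.
  have -> : q - q * q * 'X = p * (s ^+ k.+1 * w) by rewrite -kill /q; ring.
  by rewrite jpoly_eq0M.
(* The idempotent equals its square, the value of [q * q * 'X], from which a factor [x] splits
   off. *)
exists (jpoly x q); exists (jpoly x (q * q)); split=> //.
by rewrite -jpolyMX -jpolyM qq.
Qed.

Lemma jpow_add x m n : mul (jpow x m) (jpow x n) = jpow x (m + n).+1.
Proof.
elim: n => [|n IHn]; first by rewrite addn0; exact: jmulC.
by rewrite /= -jpow_comm IHn addnS.
Qed.

Lemma formally_real_reduced x n : formally_real mul -> jpow x n = 0 -> x = 0.
Proof.
move=> hF; have sq0 y : mul y y = 0 -> y = 0.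
  by move=> yy; apply: (hF [:: y]); rewrite ?big_seq1 ?mem_head.
(* The square of x^(n+1) has exponent 2n + 2, at least the exponent n + 2 of the vanishing power. *)
elim: n => [//|n IHn] xn; apply/IHn/sq0; rewrite jpow_add -addnS.
by elim: {1}n => //= m ->; rewrite linear0.
Qed.

(** * The trace form *)

Definition jtrace x := \tr (opmx (mul x)).

Lemma jtrace_scalar : scalar jtrace.
Proof.
move=> a x y; rewrite /jtrace -mxtraceZ -mxtraceD; congr mxtrace; apply: opmx_eq => u.
rewrite mulmxDr -scalemxAr !opmxE; try exact: jmul_linear.
by rewrite jmulDl jmulZl linearD linearZ.
Qed.
HB.instance Definition _ := GRing.isLinear.Build R A R *%R jtrace jtrace_scalar.

(* On the Peirce eigenvalues 0, 1/2, 1 of [L = L(e)], [2L^2 - L] and [4L - 4L^2] are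
   the projections onto the 1- and 1/2-eigenspaces. *)
Lemma jtrace_idempotent_gt0 e : e != 0 -> mul e e = e -> 0 < jtrace e.
Proof.
move=> e_neq0 ee; rewrite /jtrace; set L := opmx (mul e).
have LE u : v2r u *m L = v2r (mul e u) by rewrite opmxE//; exact: jmul_linear.
pose L2 := L *m L; pose L3 := L2 *m L; pose L4 := L3 *m L.
(* The linearized identity at [e] reads L (2L - 1) (L - 1) = 0. *)
have L3E : 2 *: L3 = 3 *: L2 - L.
  apply: opmx_eq => u; have := jordan_linearized e e u; rewrite !ee.
  rewrite mulmxBr -!scalemxAr !mulmxA !LE => /(congr1 (@v2r _ A)) E.
  apply/rowP=> i; move/rowP/(_ i): E.
  by rewrite !(mulr2n, linearD, linearN, opprD, mxE) /=; lra.
have L4E : 2 *: L4 = 3 *: L3 - L2.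
  by rewrite /L4 scalemxAl L3E mulmxBl -scalemxAl.
have entries i j : (2 * L3 i j = 3 * L2 i j - L i j) /\ (2 * L4 i j = 3 * L3 i j - L2 i j).
  by move/matrixP/(_ i j): L3E; move/matrixP/(_ i j): L4E; rewrite !mxE.
have P1 : (2 *: L2 - L) *m (2 *: L2 - L) = 2 *: L2 - L.
  rewrite !(mulmxBl, mulmxBr) -!(scalemxAl, scalemxAr) !mulmxA -/L2 -/L3 -/L4.
  by apply/matrixP=> i j; have [] := entries i j; rewrite !mxE; lra.
have P2 : (4 *: L - 4 *: L2) *m (4 *: L - 4 *: L2) = 4 *: L - 4 *: L2.
  rewrite !(mulmxBl, mulmxBr) -!(scalemxAl, scalemxAr) !mulmxA -/L2 -/L3 -/L4.
  by apply/matrixP=> i j; have [] := entries i j; rewrite !mxE; lra.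
(* The 1-eigenspace contains [e] itself. *)
have rk1 : (0 < \rank (2 *: L2 - L)%R)%N.
  rewrite lt0n mxrank_eq0; apply: contraNneq e_neq0 => P0.
  have := congr1 (mulmx (v2r e)) P0; rewrite mulmx0 mulmxBr -scalemxAr mulmxA !LE ee.
  rewrite ee scaler_nat mulr2n addrK => /eqP; rewrite -(linear0 v2r).
  by rewrite (inj_eq (@v2r_inj _ A)).
have t1 : 0 < \tr (2 *: L2 - L) by rewrite (mxtrace_idempotent P1) ltr0n.
have t2 : 0 <= \tr (4 *: L - 4 *: L2) by rewrite (mxtrace_idempotent P2) ler0n.
(* L is the first projection plus half the second. *)
by move: t1 t2; rewrite !linearB !linearZ /=; lra.
Qed.

Lemma jtrace_nondegenerate x :
  formally_real mul -> (forall y, jtrace (mul x y) = 0) -> x = 0.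
Proof.
move=> hF x0; have [[n /(formally_real_reduced hF)//]|] := jordan_idempotent_or_nilpotent x.
by move=> [e [y [e_neq0 ee eE]]]; have := jtrace_idempotent_gt0 e_neq0 ee; rewrite eE x0 ltxx.
Qed.

(** * Derivations and 2-local derivations *)

Lemma jtrace_derivation D x : is_derivation mul D -> jtrace (D x) = 0.
Proof.
move=> [Dl DM]; have Dlin : linear D by [].
have -> : jtrace (D x) = \tr (opmx (mul x) *m opmx D - opmx D *m opmx (mul x)).
  rewrite /jtrace; congr mxtrace; apply: opmx_eq => u.
  rewrite mulmxBr !mulmxA !opmxE//; try exact: jmul_linear.
  by rewrite -linearB DM addrK.
by rewrite linearB /= mxtrace_mulC subrr.
Qed.

Lemma local_derivation_skew Delta x y : is_2local_derivation mul Delta ->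
  jtrace (mul (Delta x) y) = - jtrace (mul x (Delta y)).
Proof.
move=> /(_ x y)[D [dD -> ->]]; apply/eqP; rewrite -addr_eq0 -linearD.
by have [_ DM] := dD; rewrite /= -DM (jtrace_derivation _ dD).
Qed.

Lemma local_derivation_linear Delta :
  formally_real mul -> is_2local_derivation mul Delta -> linear Delta.
Proof.
move=> hF h2 a x y; apply/eqP; rewrite -subr_eq0; apply/eqP.
apply: jtrace_nondegenerate => // z.
rewrite !(jmulDl, jmulNl, jmulZl) !(linearD, linearN, linearZ) /=.
(* Skewness moves [Delta] onto [z], leaving expressions linear in [x] and [y] that cancel. *)
rewrite !(local_derivation_skew _ _ h2) !(jmulDl, jmulZl) !(linearD, linearZ) /=.
by ring.
Qed.

Lemma local_derivation_sqr Delta x : is_2local_derivation mul Delta ->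
  Delta (mul x x) = mul x (Delta x) *+ 2.
Proof.
by move=> /(_ x (mul x x))[D [[_ DM] -> ->]]; rewrite DM jmulC mulr2n.
Qed.

End JordanTheory.

Theorem theorem5p3 (R : realType) (A : vectType R) (mul : A -> A -> A)
  (hJ : is_jordan_product mul) (hF : formally_real mul)
  (Delta : A -> A) (h2 : is_2local_derivation mul Delta) :
  is_derivation mul Delta.
Proof.
have DL := local_derivation_linear hJ hF h2; split=> // x y.
have DD u v : Delta (u + v) = Delta u + Delta v by rewrite -[u]scale1r DL !scale1r.
have sqr := local_derivation_sqr hJ _ h2.
(* Once the squares cancel, twice the Leibniz rule remains; the 2 is divided out in coordinates. *)
have := sqr (x + y); rewrite DD !(jmulDr hJ, jmulDl hJ) !DD !sqr (jmulC hJ y x).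
rewrite (jmulC hJ (Delta x)).
move=> E; apply: (@v2r_inj _ A); apply/rowP=> i.
move/(congr1 (@v2r _ A))/rowP/(_ i): E.
by rewrite !(mulr2n, linearD, mxE) /=; lra.
Qed.
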